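(* Let $K$ be a field and let $I_{\mathcal A}\subset K[x_1,\dots,x_c,y_1,\dots,y_d]$ be the simplicial toric ideal defined by $\mathcal A$, with associated semigroup $S$. Then the maximum degree in a minimal Gröbner basis of $I_{\mathcal A}$ with respect to the reverse lexicographic order is at most $\max\{r(S)+1,\ 2r(S)-1\}$, and moreover $$\max\{r(S)+1,\ 2r(S)-1\}\ \le\ \max\{2,\ 2(\deg K[S]-\operatorname{codim} K[S])-1\}.$$
   Context: Setting. $K$ is an arbitrary field, $c\ge 2$, $\alpha\ge 2$ and $d$ are natural numbers, and $M_{\alpha,d}=\{(x_1,\dots,x_d)\in\mathbb N^d : x_1+\cdots+x_d=\alpha\}$ (with $0\in\mathbb N$). $\mathcal A=\{\mathbf e_1,\dots,\mathbf e_d,\mathbf a_1,\dots,\mathbf a_c\}\subseteq M_{\alpha,d}$ is a set of $d+c$ distinct elements, where $\mathbf e_1=(\alpha,0,\dots,0),\dots,\mathbf e_d=(0,\dots,0,\alpha)$. Writing $\mathbf a_i=(a_{i1},\dots,a_{id})$, the integers $a_{ij}$ ($1\le i\le c$, $1\le j\le d$) are assumed to be relatively prime (their overall gcd is $1$). $S\subseteq\mathbb N^d$ is the (homogeneous simplicial affine) semigroup (with $0$) generated by $\mathcal A$, and $K[S]\cong K[t_1^\alpha,\dots,t_d^\alpha,\mathbf t^{\mathbf a_1},\dots,\mathbf t^{\mathbf a_c}]\subseteq K[t_1,\dots,t_d]$, where $\mathbf t^{\mathbf a_i}=t_1^{a_{i1}}\cdots t_d^{a_{id}}$. $I_{\mathcal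 A}$ is the kernel of the $K$-algebra homomorphism $K[x_1,\dots,x_c,y_1,\dots,y_d]\to K[S]$, $x_i\mapsto \mathbf t^{\mathbf a_i}$, $y_j\mapsto t_j^\alpha$; it is called the simplicial toric ideal defined by $\mathcal A$. The grading is the standard one: $\deg x_i=\deg y_j=1$, and $\mathbf b\in S$ has degree $(b_1+\cdots+b_d)/\alpha$. One has $\dim K[S]=d$ and $\operatorname{codim}K[S]=c$; $\deg K[S]$ is the multiplicity of the standard graded algebra $K[S]$. Order. The reverse lexicographic order is the graded (degree) reverse lexicographic order with $x_1>\cdots>x_c>y_1>\cdots>y_d$. The maximum degree in a minimal Gröbner basis of $I_{\mathcal A}$ is the largest degree of a minimal generator of the initial ideal $\operatorname{in}(I_{\mathcal A})$. Reduction number. $r(S)$ is the reduction number of $K[S]$ with respect to the minimal reduction $Q=(t_1^\alpha,\dots,t_d^\alpha)$, i.e. the least integer $n$ such that $[Q\,K[S]]_{n+1}=K[S]_{n+1}$. Equivalently, $r(S)$ is the least positive integer $r$ such that $(r+1)\mathcal A=\{\mathbf e_1,\dots,\mathbf e_d\}+r\mathcal A$, where $B+C=\{b+c: b\in B,c\in C\}$ and $n\mathcal A=\mathcal A+\cdots+\mathcal A$ ($n$ times). *)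

(* Defs.v *)
From HB Require Import structures.
From mathcomp Require Import all_boot all_order all_algebra.
From mathcomp Require Export mpoly.

Set Implicit Arguments.
Unset Strict Implicit.
Unset Printing Implicit Defensive.

Import GRing.Theory.

Local Open Scope ring_scope.

Section Ideals.
Context (n : nat) (K : fieldType).
Implicit Types (X I : {mpoly K[n]} -> Prop) (f g h : {mpoly K[n]}).
Implicit Types (G : seq {mpoly K[n]}).

Definition ideal_generated X f : Prop :=
  exists s : seq ({mpoly K[n]} * {mpoly K[n]}),
    (forall u, u \in s -> X u.2) /\ f = \sum_(u <- s) u.1 * u.2.

(* Graded reverse lexicographic order with 'X_0 > 'X_1 > ... > 'X_(n-1).
   The order that mpoly.v puts on 'X_{1..n} (and hence mlead) is, despite its
   header, the graded lexicographic one, so it cannot be used here. *)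
Definition drl_lt (m1 m2 : 'X_{1..n}) : bool :=
  (mdeg m1 < mdeg m2)%N
  || ((mdeg m1 == mdeg m2)
      && [exists i : 'I_n, (m2 i < m1 i)%N
            && [forall j : 'I_n, (i < j)%N ==> (m1 j == m2 j)]]).

Definition drl_max (m1 m2 : 'X_{1..n}) : 'X_{1..n} :=
  if drl_lt m1 m2 then m2 else m1.

(* The monomial 0%MM is the least one for drl_lt, hence neutral for drl_max. *)
Definition drl_lead f : 'X_{1..n} := \big[drl_max/0%MM]_(m <- msupp f) m.

Definition lead_monomials X f : Prop :=
  exists g, [/\ X g, g != 0 & f = 'X_[drl_lead g]].

Definition initial_ideal I : {mpoly K[n]} -> Prop :=
  ideal_generated (lead_monomials I).

Definition groebner_basis I G : Prop :=
  (forall g, g \in G -> I g /\ g != 0) /\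
  (forall f, initial_ideal I f <->
             ideal_generated (lead_monomials (fun g => g \in G)) f).

Definition minimal_groebner_basis I G : Prop :=
  groebner_basis I G /\
  (forall g, g \in G ->
     ~ ideal_generated (lead_monomials (fun h => h \in G /\ h <> g))
         'X_[drl_lead g]).

Definition max_degree G : nat := (\max_(g <- G) (msize g).-1)%N.

Definition has_dimension (V : {mpoly K[n]} -> Prop) (k : nat) : Prop :=
  exists b : 'I_k -> {mpoly K[n]},
    [/\ forall i, V (b i),
        forall l : 'I_k -> K, \sum_i l i *: b i = 0 -> forall i, l i = 0
      & forall f, V f -> exists l : 'I_k -> K, f = \sum_i l i *: b i].

End Ideals.

Section Simplicial.
Context (c d alpha : nat) (a : 'I_c -> 'X_{1..d}).

(* The family (a_1, ..., a_c, e_1, ..., e_d), in the order of the variables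
   x_1 > ... > x_c > y_1 > ... > y_d; elements of N^d are exponent vectors. *)
Definition simplicial_gen (k : 'I_(c + d)) : 'X_{1..d} :=
  match split k with
  | inl i => a i
  | inr j => (U_(j) *+ alpha)%MM
  end.

Definition in_semigroup (b : 'X_{1..d}) : Prop :=
  exists u : 'I_(c + d) -> nat,
    b = (\big[+%MM/0]_k (simplicial_gen k *+ u k))%MM.

Definition coord_gcd : nat :=
  (\big[gcdn/0]_(i < c) \big[gcdn/0]_(j < d) a i j)%N.

Context (K : fieldType).
Implicit Types (f : {mpoly K[d]}).

Definition toric_ideal (p : {mpoly K[c + d]}) : Prop :=
  p \mPo [tuple 'X_[simplicial_gen k] | k < c + d] = 0 :> {mpoly K[d]}.

(* K[S], as the subalgebra of K[t_1, ..., t_d] spanned by the t^b, b in S *)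
Definition semigroup_algebra f : Prop :=
  forall m, m \in msupp f -> in_semigroup m.

(* The component of degree n of K[S], where t^b has degree |b| / alpha *)
Definition semigroup_algebra_homog (n : nat) f : Prop :=
  semigroup_algebra f /\ f \is (n * alpha)%N.-homog.

(* The ideal Q K[S] of K[S], with Q = (t_1^alpha, ..., t_d^alpha) *)
Definition reduction_ideal f : Prop :=
  exists g : 'I_d -> {mpoly K[d]},
    (forall j, semigroup_algebra (g j)) /\ f = \sum_j 'X_j ^+ alpha * g j.

Definition reduces_at (n : nat) : Prop :=
  forall f, (reduction_ideal f /\ semigroup_algebra_homog n.+1 f)
            <-> semigroup_algebra_homog n.+1 f.

Definition is_reduction_number (r : nat) : Prop :=
  reduces_at r /\ forall n, reduces_at n -> (r <= n)%N.

Definition is_hilbert_polynomial (P : {poly rat}) : Prop :=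
  exists n0 : nat, forall n : nat, (n0 <= n)%N ->
    exists2 k, has_dimension (semigroup_algebra_homog n) k & P.[n%:R] = k%:R.

End Simplicial.

(* Dimension and multiplicity of a standard graded algebra of positive
   dimension, read off its Hilbert polynomial P: the dimension is
   deg P + 1 = size P, and the leading coefficient is e / (dim - 1)!. *)
Definition hilbert_dim (P : {poly rat}) : nat := size P.

Definition hilbert_multiplicity (P : {poly rat}) : rat :=
  lead_coef P * ((hilbert_dim P).-1)`!%:R.

(* Codimension of a quotient of a polynomial ring in n variables *)
Definition hilbert_codim (n : nat) (P : {poly rat}) : rat :=
  n%:R - (hilbert_dim P)%:R.

(* Main.v *)
Require Import Defs.
From mathcomp Require Import all_boot all_order all_algebra.
From mathcomp Require Import mpoly.
From mathcomp Require Import zify lra.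
From mathcomp Require polyrcf.

Set Implicit Arguments.
Unset Strict Implicit.
Unset Printing Implicit Defensive.

Import Order.TTheory GRing.Theory Num.Theory.
Local Open Scope ring_scope.

(** The toric ideal is spanned by binomials, so everything happens on monomials:
    write phi (below [toric_exp]) for the map sending the monomial x^u y^v to
    its exponent in S.  A monomial is the leading monomial of an element of
    the ideal iff some smaller monomial has the same image under phi
    ([nonstandard_toric_lead], [toric_binomial]), and the leading monomials of
    a minimal Groebner basis are the divisibility-minimal such monomials.

    Degree bound ([minimal_nonstandard_mdeg]).  By definition of r, every
    x-monomial of degree r+1 has the same image as a monomial involving some
    y_j, which is smaller for the reverse lexicographic order.  So a minimal
    nonstandard m = x^u y^v has degree r+1, or |u| <= r.  In the latter case
    take a smaller x^u' y^v' with the same image and |u'| <= r; minimality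
    of m makes the two monomials coprime.  In the coordinates where v is
    nonzero, alpha v is then bounded by the contribution of x^u', hence
    |v| <= |u'| <= r and deg m <= 2r.  If equality holds, the contribution of
    x^u' is exactly alpha v, so that x^u and y^v' have the same image and
    x^u, a proper divisor of m, is already nonstandard.

    Comparison with the multiplicity.  It suffices to show r <= e - c for
    r >= 2.  As r is least, some monomial m of degree r has no monomial
    involving a y_j with the same image.  Two divisors of m, one dividing the
    other, can have images congruent modulo alpha only if these images are
    equal: otherwise the difference would be a nonzero sum of elements e_j,
    which would occur in a monomial with the image of m
    ([apery_residue_inj]).  Thus 0, a_1, ..., a_c and the images of the
    prefixes of m of degrees 2, ..., r lie in c + r different classes modulo
    alpha ([apery_residues]).  Each class contributes a translate of
    (alpha N)^d to S, hence about n^(d-1) / (d-1)! monomials in degree n.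
    The Hilbert polynomial, which is also bounded above by the number of all
    monomials of degree n alpha, therefore has degree d - 1 and multiplicity
    e >= c + r ([hilbert_polynomial_lead]). *)

(** * Degree reverse lexicographic order *)

Section DegRevLex.
Context (n : nat).
Implicit Types m : 'X_{1..n}.

Lemma drl_ltP m1 m2 :
  reflect ((mdeg m1 < mdeg m2)%N \/
           mdeg m1 = mdeg m2 /\
           exists2 i : 'I_n, (m2 i < m1 i)%N &
             forall j : 'I_n, (i < j)%N -> m1 j = m2 j)
          (drl_lt m1 m2).
Proof.
apply: (iffP orP) => [[lt12|/andP[/eqP eq12 /existsP[i /andP[lti /forallP eqj]]]]|].
- by left.
- right; split=> //; exists i => // j ltij.
  by apply/eqP; apply: implyP ltij.
- case=> [lt12|[eq12 [i lti eqj]]]; [by left | right].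
  rewrite eq12 eqxx; apply/existsP; exists i; rewrite lti.
  by apply/forallP=> j; apply/implyP=> /eqj ->.
Qed.

Lemma drl_lt_irr m : drl_lt m m = false.
Proof. by apply/drl_ltP => -[|[_ [i]]]; rewrite ltnn. Qed.

Lemma drl_lt_trans m2 m1 m3 : drl_lt m1 m2 -> drl_lt m2 m3 -> drl_lt m1 m3.
Proof.
move=> /drl_ltP[lt12|[eq12 [i lti eqi]]] /drl_ltP[lt23|[eq23 [k ltk eqk]]];
  apply/drl_ltP.
- by left; apply: ltn_trans lt23.
- by left; rewrite -eq23.
- by left; rewrite eq12.
- right; split; first by rewrite eq12.
  case: (ltngtP i k) => [ltik|ltki|/val_inj eqik].
  + exists k => [|j ltkj]; first by rewrite eqi.
    by rewrite eqi ?eqk // (ltn_trans ltik).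
  + exists i => [|j ltij]; first by rewrite -eqk.
    by rewrite eqi // eqk // (ltn_trans ltki).
  + rewrite -{k}eqik in ltk eqk; exists i => [|j ltij].
      exact: ltn_trans lti.
    by rewrite eqi ?eqk.
Qed.

Lemma drl_lt_total m1 m2 : [|| m1 == m2, drl_lt m1 m2 | drl_lt m2 m1].
Proof.
case: (ltngtP (mdeg m1) (mdeg m2)) => [lt|lt|eqd].
- by rewrite /drl_lt lt orbT.
- by rewrite /drl_lt lt !orbT.
have [//|ne] := eqVneq m1 m2.
have /existsP[i0 ne0] : [exists i, m1 i != m2 i].
  rewrite -negb_forall; apply: contra ne => /forallP eqm.
  by apply/eqP/mnmP => i; apply/eqP.
have [i nei maxi] :=
  arg_maxnP (P := fun i => m1 i != m2 i) (fun i : 'I_n => val i) ne0.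
have eqj (j : 'I_n) : (i < j)%N -> m1 j = m2 j.
  move=> ltij; apply: contraTeq ltij => /maxi; rewrite -leqNgt; exact.
move: nei; rewrite neq_ltn orFb => /orP[lti|lti].
- by apply/orP; right; apply/drl_ltP; right; split=> //; exists i => // j /eqj ->.
- by apply/orP; left; apply/drl_ltP; right; split=> //; exists i => // j /eqj ->.
Qed.

Lemma drl_lt_add2l m m1 m2 : drl_lt (m + m1)%MM (m + m2)%MM = drl_lt m1 m2.
Proof.
rewrite /drl_lt !mdegD ltn_add2l eqn_add2l; congr (_ || (_ && _)).
apply: eq_existsb => i; rewrite !mnmDE ltn_add2l; congr (_ && _).
by apply: eq_forallb => j; rewrite !mnmDE eqn_add2l.
Qed.

Lemma drl_lt0 m : m != 0%MM -> drl_lt 0%MM m.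
Proof. by rewrite -mdeg_eq0 -lt0n /drl_lt mdeg0 => ->. Qed.

Lemma drl_lt_leq_mdeg m1 m2 : drl_lt m1 m2 -> (mdeg m1 <= mdeg m2)%N.
Proof. by case/drl_ltP => [/ltnW|[-> _]]. Qed.

(** The seed of the iterated maximum is 0, the least monomial, so the maximum
    is attained as soon as the list is nonempty. *)
Lemma big_drl_max (s : seq 'X_{1..n}) (M := \big[@drl_max n/0%MM]_(m <- s) m) :
  s != [::] -> M \in s /\ (forall m, m \in s -> m = M \/ drl_lt m M).
Proof.
rewrite {}/M; elim: s => [//|m s IHs] _; rewrite big_cons.
have [->|/IHs] := eqVneq s [::].
  rewrite big_nil /drl_max; case: ifPn => [ltm0|_].
    have [eqm0|/drl_lt0 lt0m] := eqVneq m 0%MM.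
      by rewrite eqm0 drl_lt_irr in ltm0.
    by have := drl_lt_trans ltm0 lt0m; rewrite drl_lt_irr.
  by rewrite inE eqxx; split=> // m'; rewrite inE => /eqP->; left.
set M := \big[_/_]_(_ <- s) _ => -[sM maxM].
rewrite /drl_max; case: ifPn => [ltmM|nltmM].
  rewrite inE sM orbT; split=> // m' /[!inE] /orP[/eqP->|/maxM //]; by right.
rewrite inE eqxx; split=> // m' /[!inE] /orP[/eqP->|/maxM]; first by left.
have := drl_lt_total m M; rewrite (negPf nltmM) /= => /orP[/eqP-> //|ltMm].
by case=> [->|/drl_lt_trans]; [right | move/(_ _ ltMm); right].
Qed.

End DegRevLex.

(** * Leading monomials and minimal Groebner bases *)

Section InitialIdeals.
Context (n : nat) (K : fieldType).
Implicit Types (m : 'X_{1..n}) (f g : {mpoly K[n]}) (X I : {mpoly K[n]} -> Prop).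

Lemma drl_lead_supp f : f != 0 -> drl_lead f \in msupp f.
Proof. by rewrite -msupp_eq0 => /big_drl_max[]. Qed.

Lemma drl_lead_max f m :
  m \in msupp f -> m = drl_lead f \/ drl_lt m (drl_lead f).
Proof.
move=> fm; have /big_drl_max[_] : msupp f != [::].
  by apply: contraTneq fm => ->.
exact.
Qed.

Lemma msize_drl_lead f : ((msize f).-1 <= mdeg (drl_lead f))%N.
Proof.
suff: (msize f <= (mdeg (drl_lead f)).+1)%N by case: (msize f).
rewrite msizeE; apply/bigmax_leqP_seq => m fm _; rewrite ltnS.
by case: (drl_lead_max fm) => [->|/drl_lt_leq_mdeg].
Qed.

Lemma monomial_in_lead_ideal X m :
  ideal_generated (lead_monomials X) 'X_[m] <->
  exists g, [/\ X g, g != 0 & (drl_lead g <= m)%MM].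
Proof.
split=> [[s [sX eqm]]|[g [Xg nzg legm]]].
  have: m \in msupp ('X_[m] : {mpoly K[n]}) by rewrite msuppX inE.
  rewrite eqm => /msupp_sum_le /flattenP[_ /mapP[u su ->]].
  rewrite mem_filter /= in su; have [g [Xg nzg ->]] := sX u su.
  rewrite (perm_mem (msuppMX _ _)) => /mapP[m' _ ->].
  by exists g; split=> //; apply: lem_addr.
exists [:: ('X_[m - drl_lead g]%MM, 'X_[drl_lead g])]; split.
  by move=> u; rewrite inE => /eqP->; exists g.
by rewrite big_seq1 -mpolyXD submK.
Qed.

(** A leading monomial of I below that of g is a multiple of the leading
    monomial of some basis element h; were it a proper divisor, h would
    differ from g and make g redundant. *)
Lemma minimal_groebner_lead I G g f :
    minimal_groebner_basis I G -> g \in G -> I f -> f != 0 ->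
    (drl_lead f <= drl_lead g)%MM ->
  drl_lead f = drl_lead g.
Proof.
move=> [[GI initG] minG] Gg If nzf lefg.
have: initial_ideal I 'X_[drl_lead f].
  by apply/monomial_in_lead_ideal; exists f; split=> //; apply: lepm_refl.
move/initG/monomial_in_lead_ideal => [h [Gh nzh lehf]].
have [eqhg|nehg] := eqVneq h g.
  rewrite eqhg in lehf; apply/mnmP => i; apply/eqP.
  by rewrite eqn_leq (mnm_lepP lefg) (mnm_lepP lehf).
case: (minG g Gg); apply/monomial_in_lead_ideal; exists h; split=> //.
  by split=> //; apply/eqP.
exact: lepm_trans lefg.
Qed.

End InitialIdeals.

(** * Monomials and their images in the semigroup *)

Section ToricMonomials.
Context (c d alpha : nat) (a : 'I_c -> 'X_{1..d}).
Implicit Types (m : 'X_{1..c + d}) (v : 'X_{1..d}).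

Local Notation gen := (simplicial_gen alpha a).

(** The exponent of the image of the monomial m in K[S]. *)
Definition toric_exp m : 'X_{1..d} :=
  (\big[+%MM/0%MM]_k (gen k *+ m k))%MM.

Definition xdeg m : nat := \sum_(i < c) m (lshift d i).
Definition ydeg m : nat := \sum_(j < d) m (rshift c j).

Definition xpart m : 'X_{1..c + d} :=
  [multinom if split k is inl _ then m k else 0%N | k < c + d].

Definition ymon v : 'X_{1..c + d} :=
  [multinom if split k is inr j then v j else 0%N | k < c + d].

Lemma gen_lshift i : gen (lshift d i) = a i.
Proof. by rewrite /simplicial_gen (unsplitK (inl i)). Qed.

Lemma gen_rshift j : gen (rshift c j) = (U_(j) *+ alpha)%MM.
Proof. by rewrite /simplicial_gen (unsplitK (inr j)). Qed.

Lemma xpart_lshift m i : xpart m (lshift d i) = m (lshift d i).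
Proof. by rewrite mnmE (unsplitK (inl i)). Qed.

Lemma xpart_rshift m j : xpart m (rshift c j) = 0%N.
Proof. by rewrite mnmE (unsplitK (inr j)). Qed.

Lemma ymon_lshift v i : ymon v (lshift d i) = 0%N.
Proof. by rewrite mnmE (unsplitK (inl i)). Qed.

Lemma ymon_rshift v j : ymon v (rshift c j) = v j.
Proof. by rewrite mnmE (unsplitK (inr j)). Qed.

Lemma xpart_le m : (xpart m <= m)%MM.
Proof. by apply/mnm_lepP => k; rewrite mnmE; case: split. Qed.

Lemma ydeg_xpart m : ydeg (xpart m) = 0%N.
Proof. by rewrite /ydeg big1 // => j _; rewrite xpart_rshift. Qed.

Lemma xdeg_xpart m : xdeg (xpart m) = xdeg m.
Proof. by apply: eq_bigr => i _; rewrite xpart_lshift. Qed.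

Lemma ydeg_ymon v : ydeg (ymon v) = mdeg v.
Proof. by rewrite mdegE; apply: eq_bigr => j _; rewrite ymon_rshift. Qed.

Lemma mdeg_xydeg m : mdeg m = (xdeg m + ydeg m)%N.
Proof. by rewrite mdegE big_split_ord. Qed.

Lemma xdegD m1 m2 : xdeg (m1 + m2)%MM = (xdeg m1 + xdeg m2)%N.
Proof. by rewrite -big_split; apply: eq_bigr => i _; rewrite mnmDE. Qed.

Lemma ydegD m1 m2 : ydeg (m1 + m2)%MM = (ydeg m1 + ydeg m2)%N.
Proof. by rewrite -big_split; apply: eq_bigr => i _; rewrite mnmDE. Qed.

Lemma ydeg_le m1 m2 : (m1 <= m2)%MM -> (ydeg m1 <= ydeg m2)%N.
Proof. by move/mnm_lepP => le12; apply: leq_sum => j _; apply: le12. Qed.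

Lemma ydeg_gt0 m : (0 < ydeg m)%N -> exists j, (0 < m (rshift c j))%N.
Proof.
move=> ym; apply/existsP; move: ym; apply: contraTT.
rewrite negb_exists => /forallP m0; rewrite -eqn0Ngt sum_nat_eq0.
by apply/forallP => j; rewrite -leqn0 leqNgt m0.
Qed.

Lemma toric_expE m j :
  toric_exp m j =
    (\sum_(i < c) a i j * m (lshift d i) + alpha * m (rshift c j))%N.
Proof.
rewrite mnm_sumE big_split_ord /=; congr (_ + _)%N.
  by apply: eq_bigr => i _; rewrite gen_lshift mulmnE.
rewrite (bigD1 j) //= big1 => [|j' ne_jj'].
  by rewrite gen_rshift !mulmnE mnm1E eqxx mul1n addn0.
by rewrite gen_rshift !mulmnE mnm1E (negPf ne_jj').
Qed.

Lemma toric_expD m1 m2 :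
  toric_exp (m1 + m2)%MM = (toric_exp m1 + toric_exp m2)%MM.
Proof.
apply/mnmP => j; rewrite mnmDE !mnm_sumE -big_split /=.
by apply: eq_bigr => k _; rewrite !mulmnE mnmDE mulnDr.
Qed.

Lemma toric_exp0 : toric_exp 0%MM = 0%MM.
Proof. by apply: big1 => k _; rewrite mnm0E. Qed.

Lemma toric_expU k : toric_exp U_(k)%MM = gen k.
Proof.
rewrite /toric_exp (bigD1 k) //= mnm1E eqxx big1 ?addm0 // => k' ne_kk'.
by rewrite mnm1E eq_sym (negPf ne_kk').
Qed.

Lemma toric_exp_ymon v : toric_exp (ymon v) = (v *+ alpha)%MM.
Proof.
apply/mnmP => j; rewrite toric_expE ymon_rshift mulmnE mulnC.
by rewrite big1 // => i _; rewrite ymon_lshift muln0.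
Qed.

Lemma toric_exp_le m1 m2 :
  (m1 <= m2)%MM -> (toric_exp m1 <= toric_exp m2)%MM.
Proof. by move/submK <-; rewrite toric_expD lem_addl. Qed.

Lemma in_semigroupP v : in_semigroup alpha a v <-> exists m, v = toric_exp m.
Proof.
split=> [[u ->]|[m ->]]; last by exists m.
by exists [multinom u k | k < c + d]; apply: eq_bigr => k _; rewrite mnmE.
Qed.

Context (a_deg : forall i, mdeg (a i) = alpha).

Lemma mdeg_gen k : mdeg (gen k) = alpha.
Proof.
by rewrite -(splitK k); case: split => [i|j];
  rewrite ?gen_lshift ?gen_rshift // mdegMn mdeg1 mul1n.
Qed.

Lemma mdeg_toric_exp m : mdeg (toric_exp m) = (mdeg m * alpha)%N.
Proof.
rewrite mdeg_sum mdegE big_distrl; apply: eq_bigr => k _ /=.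
by rewrite mdegMn mdeg_gen mulnC.
Qed.

Context (alpha_gt0 : (0 < alpha)%N).

Lemma toric_exp_mdeg m1 m2 : toric_exp m1 = toric_exp m2 -> mdeg m1 = mdeg m2.
Proof.
move/(congr1 mdeg); rewrite !mdeg_toric_exp => /eqP.
by rewrite eqn_pmul2r // => /eqP.
Qed.

(** Reverse lexicographic order looks first at the last variable where two
    monomials differ; if only m1 involves y variables, that variable is the
    last y dividing m1. *)
Lemma drl_lt_ydeg m1 m2 :
    mdeg m1 = mdeg m2 -> ydeg m2 = 0%N -> (0 < ydeg m1)%N ->
  drl_lt m1 m2.
Proof.
move=> eqd y2 /ydeg_gt0[j0 mj0]; apply/drl_ltP; right; split=> //.
have [j mj maxj] :=
  arg_maxnP (P := fun j => 0 < m1 (rshift c j))%N (fun j : 'I_d => val j) mj0.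
have m20 j' : m2 (rshift c j') = 0%N.
  by apply/eqP; move/eqP: y2; rewrite sum_nat_eq0 => /forallP/(_ j').
exists (rshift c j) => [|k]; first by rewrite m20.
rewrite -{1 2 3}(splitK k); case: split => [i|j'] /=.
  by rewrite ltnNge (leq_trans (ltnW (ltn_ord i))) ?leq_addr.
rewrite ltn_add2l m20 => ltjj'; apply/eqP; apply: contraLR ltjj'.
by rewrite -lt0n -leqNgt => /maxj.
Qed.

End ToricMonomials.

(** * Leading monomials of the toric ideal *)

Section ToricLeads.
Context (K : fieldType) (c d alpha : nat) (a : 'I_c -> 'X_{1..d}).
Implicit Types (m : 'X_{1..c + d}) (g : {mpoly K[c + d]}).

Local Notation gen := (simplicial_gen alpha a).
Local Notation phi := (toric_exp alpha a).
Local Notation toric := (@toric_ideal c d alpha a K).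

(** The monomials of the initial ideal of the toric ideal. *)
Definition nonstandard m := exists2 m', phi m' = phi m & drl_lt m' m.

Lemma comp_toric_monomial m :
  'X_[m] \mPo [tuple 'X_[gen k] | k < c + d] = 'X_[phi m] :> {mpoly K[d]}.
Proof.
rewrite comp_mpolyX /toric_exp; symmetry.
rewrite (big_morph (fun v => 'X_[v]) (@mpolyXD _ _) (@mpolyX0 _ _)).
by apply: eq_bigr => k _; rewrite tnth_mktuple mpolyXn.
Qed.

(** If no other monomial of g had the image of the leading one, the leading
    coefficient would survive in the image of g. *)
Lemma nonstandard_toric_lead g : toric g -> g != 0 -> nonstandard (drl_lead g).
Proof.
rewrite /toric_ideal comp_mpolyEX => g0 nzg.
set m := drl_lead g; have gm : m \in msupp g by apply: drl_lead_supp.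
have /hasP[m' gm' /andP[nem' /eqP eqphi]] :
    has (fun m' => (m' != m) && (phi m' == phi m)) (msupp g).
  apply: contraLR gm => /hasPn no_m'; rewrite -mcoeff_eq0.
  case gm : (m \in msupp g); last by rewrite mcoeff_eq0 gm.
  have/(congr1 (mcoeff (phi m))) := g0.
  rewrite raddf_sum mcoeff0 (bigD1_seq m) ?msupp_uniq //= big_seq_cond big1.
    by rewrite addr0 mcoeffZ comp_toric_monomial mcoeffX eqxx mulr1 => ->.
  move=> m' /andP[/no_m' ne_m' nem'].
  rewrite mcoeffZ comp_toric_monomial mcoeffX.
  by rewrite nem' /= in ne_m'; rewrite (negPf ne_m') mulr0.
exists m' => //; case: (drl_lead_max gm') => // eqm'.
by rewrite eqm' eqxx in nem'.
Qed.

Lemma toric_binomial m : nonstandard m ->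
  exists g, [/\ toric g, g != 0 & drl_lead g = m].
Proof.
move=> [m' eqphi ltm'm]; pose g : {mpoly K[c + d]} := 'X_[m] - 'X_[m'].
have nem' : m' != m by apply: contraTneq ltm'm => ->; rewrite drl_lt_irr.
have gm : m \in msupp g.
  by rewrite mcoeff_msupp mcoeffB !mcoeffX eqxx (negPf nem') subr0 oner_neq0.
have nzg : g != 0 by apply: contraTneq gm => ->; rewrite msupp0.
exists g; split=> //.
  by rewrite /toric_ideal comp_mpolyB !comp_toric_monomial eqphi subrr.
have := drl_lead_supp nzg; move/msuppB_le; rewrite mem_cat !msuppX !inE.
case/orP => /eqP // eqm'; case: (drl_lead_max gm) => [//|]; rewrite eqm'.
by move/(drl_lt_trans ltm'm); rewrite drl_lt_irr.
Qed.

Lemma minimal_groebner_nonstandard G g m :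
    minimal_groebner_basis toric G -> g \in G -> nonstandard m ->
    (m <= drl_lead g)%MM ->
  m = drl_lead g.
Proof.
move=> minG Gg /toric_binomial[f [If nzf <-]].
exact: minimal_groebner_lead minG Gg If nzf.
Qed.

Context (a_deg : forall i, mdeg (a i) = alpha).
Context (alpha_gt0 : (0 < alpha)%N).
Context (r : nat).

(** Read off from a decomposition of t^(phi m) in Q K[S]: the monomial must
    occur in one of the summands t_j^alpha g_j. *)
Lemma reduces_at_toric_exp : reduces_at alpha a K r ->
  forall m, mdeg m = r.+1 -> exists2 m', phi m' = phi m & (0 < ydeg m')%N.
Proof.
move=> red m degm; have [_] := red 'X_[phi m].
have hom_m : semigroup_algebra_homog alpha a r.+1 ('X_[phi m] : {mpoly K[d]}).
  split=> [v|]; last by rewrite dhomogX /= (mdeg_toric_exp a_deg) degm.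
  by rewrite msuppX inE => /eqP->; apply/in_semigroupP; exists m.
move/(_ hom_m) => [[g [Sg eqg]] _].
have: phi m \in msupp ('X_[phi m] : {mpoly K[d]}) by rewrite msuppX inE.
rewrite eqg => /msupp_sum_le /flattenP[_ /mapP[j _ ->]].
rewrite mpolyXn mulrC (perm_mem (msuppMX _ _)) => /mapP[v gv eqv].
have /in_semigroupP[m' eqm'] := Sg j v gv.
exists (U_(rshift c j) + m')%MM.
  by rewrite toric_expD toric_expU gen_rshift -eqm' -eqv.
rewrite ydegD /ydeg (bigD1 j) //= mnm1E eqxx addnAC addnC addnA.
by rewrite addn1.
Qed.

Lemma exists_submonomial m k : (k <= mdeg m)%N ->
  exists2 m', (m' <= m)%MM & mdeg m' = k.
Proof.
elim: k => [|k IHk] lek; first by exists 0%MM; rewrite ?mdeg0 //; apply/mnm_lepP => i; rewrite mnm0E.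
have [m' lem' degm'] := IHk (ltnW lek).
have: (m - m')%MM != 0%MM.
  apply: contraTneq lek => eq0; rewrite -leqNgt -{}degm'.
  by rewrite -(submK lem') eq0 add0m.
rewrite -mdeg_eq0 mdegE sum_nat_eq0 negb_forall => /existsP[i].
rewrite mnmBE /= => nzi; exists (m' + U_(i))%MM.
  apply/mnm_lepP => j; rewrite mnmDE mnm1E; have := mnm_lepP lem' j.
  by case: eqP => [<-|] /=; lia.
by rewrite mdegD mdeg1 degm' addn1.
Qed.

Context (red_r : reduces_at alpha a K r).

Lemma nonstandard_of_xdeg m : (r < xdeg m)%N ->
  exists m1, [/\ (m1 <= m)%MM, mdeg m1 = r.+1 & exists m2,
    [/\ phi m2 = phi m1, drl_lt m2 m1, ydeg m1 = 0%N & (0 < ydeg m2)%N]].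
Proof.
move=> xm; have [|m1 lem1 degm1] := @exists_submonomial (xpart m) r.+1.
  by rewrite mdeg_xydeg xdeg_xpart ydeg_xpart addn0.
have y1 : ydeg m1 = 0%N.
  by apply/eqP; rewrite -leqn0 -(ydeg_xpart m); apply: ydeg_le.
have [m2 eq12 y2] := reduces_at_toric_exp red_r degm1.
exists m1; split=> //; first exact: lepm_trans lem1 (xpart_le m).
exists m2; split=> //; apply: drl_lt_ydeg => //.
exact: (toric_exp_mdeg a_deg).
Qed.

(** As long as m' has x-degree above r, a factor of its x-part can be
    replaced by a smaller monomial involving y, which lowers the x-degree. *)
Lemma nonstandard_small_xdeg m : nonstandard m ->
  exists m', [/\ phi m' = phi m, drl_lt m' m & (xdeg m' <= r)%N].
Proof.
move=> [m' eqm' ltm'].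
have [k] := ubnP (xdeg m'); elim: k m' eqm' ltm' => // k IHk m' eqm' ltm' xk.
have [xm'|/nonstandard_of_xdeg] := leqP (xdeg m') r; first by exists m'.
move=> [m1 [lem1 deg1 [m2 [eq12 lt21 y1 y2]]]].
have eqm : (m' = (m' - m1) + m1)%MM by rewrite submK.
apply: (IHk ((m' - m1) + m2)%MM).
- by rewrite toric_expD eq12 -toric_expD -eqm.
- by apply: drl_lt_trans ltm'; rewrite {2}eqm drl_lt_add2l.
- have := toric_exp_mdeg a_deg alpha_gt0 eq12; rewrite !mdeg_xydeg.
  by move: xk; rewrite {1}eqm !xdegD; lia.
Qed.

(** In each coordinate j, one of the two monomials is free of y_j, so the
    y_j-contribution of m has to be matched by the x-part of m', whose
    coordinates P j add up to alpha times its degree. *)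
Lemma toric_disjoint_ydeg m m' (P := fun j => (\sum_(i < c) a i j * m' (lshift d i))%N) :
    phi m' = phi m -> (forall k, m k = 0%N \/ m' k = 0%N) ->
  [/\ forall j, (alpha * m (rshift c j) <= P j)%N,
      (\sum_(j < d) alpha * m (rshift c j) = alpha * ydeg m)%N
    & (\sum_(j < d) P j = alpha * xdeg m')%N].
Proof.
move=> eqphi disj; split=> [j||].
- have := congr1 (fun v : 'X_{1..d} => v j) eqphi; rewrite !toric_expE /P.
  by case: (disj (rshift c j)) => ->; lia.
- by rewrite -big_distrr.
- rewrite exchange_big /xdeg big_distrr; apply: eq_bigr => i _ /=.
  by rewrite -big_distrl -mdegE a_deg.
Qed.

(** The Groebner degree bound, on monomials.  The strictness in 2r comes
    from minimality: degree 2r would force the x-part of m to be nonstandard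
    by itself. *)
Lemma minimal_nonstandard_mdeg m :
    nonstandard m ->
    (forall m1, nonstandard m1 -> (m1 <= m)%MM -> m1 = m) ->
  (mdeg m <= r.+1)%N \/ (mdeg m < r.*2)%N.
Proof.
move=> nsm minm.
have [xm|/nonstandard_of_xdeg[m1 [le1 deg1 [m2 [eq12 lt21 _ _]]]]] :=
  leqP (xdeg m) r; last first.
  by left; rewrite -(minm m1) ?deg1 //; exists m2.
have [m' [eqm' ltm' xm']] := nonstandard_small_xdeg nsm.
(* Cancelling a common variable would give a smaller nonstandard divisor. *)
have disj k : m k = 0%N \/ m' k = 0%N.
  have [|mk] := eqVneq (m k) 0%N; first by left.
  have [|m'k] := eqVneq (m' k) 0%N; first by right.
  have eqm : (m = U_(k) + (m - U_(k)))%MM by rewrite addmC submK // lep1mP.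
  have eqm'k : (m' = U_(k) + (m' - U_(k)))%MM by rewrite addmC submK // lep1mP.
  have : (m - U_(k))%MM = m.
    apply: minm (lem_subr _ _); exists (m' - U_(k))%MM.
      apply: (@addmI _ (gen k)).
      by rewrite -(toric_expU alpha a) -!toric_expD -eqm -eqm'k.
    by rewrite eqm eqm'k drl_lt_add2l in ltm'.
  move/(congr1 (fun v : 'X_{1..c + d} => v k)).
  by rewrite mnmBE mnm1E eqxx; lia.
have [leP eqy eqx] := toric_disjoint_ydeg eqm' disj.
have leyx : (ydeg m <= xdeg m')%N.
  by rewrite -(leq_pmul2l alpha_gt0) -eqy -eqx leq_sum.
rewrite mdeg_xydeg; have [|] := ltnP (xdeg m + ydeg m) r.*2; first by right.
move=> le2; have [xmr ymr xm'r] : [/\ xdeg m = r, ydeg m = r & xdeg m' = r].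
  by split; lia.
have [r0|r_gt0] := posnP r; first by left; rewrite xmr ymr r0.
(* Both sides of the coordinatewise bound have the same sum alpha * r. *)
have eqP' j : (\sum_(i < c) a i j * m' (lshift d i) = alpha * m (rshift c j))%N.
  have [_] := leqif_sum (fun j (_ : xpredT j) => leqif_eq (leP j)).
  by rewrite eqx eqy ymr xm'r eqxx => /esym/forall_inP/(_ j isT)/eqP.
(* The y-part of m' has the image of the x-part of m, since x^u' and y^v
   cancel from the equality of images. *)
pose u := [multinom m' (rshift c j) | j < d].
have eqxm : phi (ymon c u) = phi (xpart m).
  apply/mnmP => j; rewrite toric_exp_ymon mulmnE mnmE toric_expE xpart_rshift.
  under eq_bigr => i _ do rewrite xpart_lshift.
  have := congr1 (fun v : 'X_{1..d} => v j) eqm'.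
  by rewrite !toric_expE eqP' [LHS]addnC muln0 addn0 mulnC => /addIn.
have degxm : mdeg (xpart m) = r by rewrite mdeg_xydeg xdeg_xpart ydeg_xpart addn0.
have degu : mdeg (ymon c u) = r by rewrite (toric_exp_mdeg a_deg _ eqxm).
have : xpart m = m.
  apply: minm (xpart_le m); exists (ymon c u) => //.
  apply: drl_lt_ydeg; rewrite ?ydeg_xpart ?degu //.
  rewrite mdeg_xydeg in degu; rewrite -{}degu in r_gt0.
  move: r_gt0; rewrite /xdeg big1 // => i _; exact: ymon_lshift.
by move/(congr1 (@ydeg c d)); rewrite ydeg_xpart ymr => r0; rewrite -r0 in r_gt0.
Qed.

Lemma max_degree_minimal_groebner G :
    minimal_groebner_basis toric G ->
  (max_degree G <= r.+1)%N || (max_degree G < r.*2)%N.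
Proof.
move=> minG.
suff: (max_degree G <= maxn r.+1 r.*2.-1)%N by lia.
apply/bigmax_leqP_seq => g Gg _; apply: leq_trans (msize_drl_lead g) _.
have [Ig nzg] := minG.1.1 g Gg.
have := @minimal_nonstandard_mdeg (drl_lead g) (nonstandard_toric_lead Ig nzg).
case=> [m1 ns1||]; [exact: minimal_groebner_nonstandard minG Gg ns1 | lia | lia].
Qed.

End ToricLeads.

(** * Dimensions of spaces of polynomials *)

Section Dimension.
Context (K : fieldType).

Lemma independent_leq_span (V : lmodType K) k N (p : 'I_k -> V) (q : 'I_N -> V) :
    (forall l : 'I_k -> K, \sum_i l i *: p i = 0 -> forall i, l i = 0) ->
    (forall i, exists l : 'I_N -> K, p i = \sum_j l j *: q j) ->
  (k <= N)%N.
Proof.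
move=> indep /fin_all_exists[A eqp]; pose M : 'M[K]_(k, N) := \matrix_(i, j) A i j.
suff /eqP <- : row_free M by apply: rank_leq_col.
rewrite -kermx_eq0; apply/rowV0P => x /sub_kermxP xM0.
apply/rowP => i; rewrite mxE; move: i; apply: indep.
under eq_bigr => i _ do rewrite eqp scaler_sumr.
rewrite exchange_big big1 // => j _ /=.
under eq_bigr => i _ do rewrite scalerA.
rewrite -scaler_suml; have := congr1 (fun y : 'rV_N => y 0 j) xM0.
rewrite !mxE => eq0; rewrite (eq_bigr (fun i => x 0 i * M i j)) => [|i _].
  by rewrite eq0 scale0r.
by rewrite mxE.
Qed.

Context (n : nat) (V : {mpoly K[n]} -> Prop).
Implicit Type s : seq 'X_{1..n}.

Lemma has_dimension_geq k s : has_dimension V k ->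
  uniq s -> (forall m, m \in s -> V 'X_[m]) -> (size s <= k)%N.
Proof.
move=> [b [_ _ spanV]] uniq_s Vs.
apply: (@independent_leq_span _ _ _
  (fun i : 'I_(size s) => 'X_[nth 0%MM s i] : {mpoly K[n]}) b) => [l eq0 i|i].
  have := congr1 (mcoeff (nth 0%MM s i)) eq0.
  rewrite raddf_sum mcoeff0 (bigD1 i) //= big1 => [|j neji].
    by rewrite mcoeffZ mcoeffX eqxx mulr1 addr0.
  by rewrite mcoeffZ mcoeffX nth_uniq // (inj_eq val_inj) (negPf neji) mulr0.
exact/spanV/Vs/mem_nth.
Qed.

Lemma has_dimension_leq k s : has_dimension V k ->
  (forall f, V f -> {subset msupp f <= s}) -> (k <= size s)%N.
Proof.
move=> [b [Vb indep _]] suppV.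
have {}suppV f : V f -> {subset msupp f <= undup s}.
  by move=> Vf m /suppV; rewrite mem_undup; apply.
apply: leq_trans (size_undup s).
apply: (@independent_leq_span _ _ _ b
  (fun i : 'I_(size (undup s)) => 'X_[nth 0%MM (undup s) i] : {mpoly K[n]})) => // i.
exists (fun j => (b i)@_(nth 0%MM (undup s) j)).
rewrite -(big_mkord xpredT (fun j => (b i)@_(nth 0%MM (undup s) j) *:
            'X_[nth 0%MM (undup s) j])).
rewrite -(big_nth 0%MM xpredT (fun m => (b i)@_m *: 'X_[m])).
rewrite [LHS]mpolyE [RHS](bigID (fun m => m \in msupp (b i))) /= [X in _ + X]big1 => [|m].
  rewrite addr0 -[RHS]big_filter; apply: perm_big.
  apply: uniq_perm => [||m]; rewrite ?filter_uniq ?undup_uniq //.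
  rewrite mem_filter; case bm: (m \in msupp (b i)) => //=.
  by rewrite (suppV _ (Vb i)).
by move/memN_msupp_eq0 ->; rewrite scale0r.
Qed.

End Dimension.

(** * Growth of polynomials *)

Section PolynomialGrowth.

(** Stated for the coefficient in degree k, without asking that k is the
    degree, so that it applies to a difference of polynomials in which the
    leading terms might cancel. *)
Lemma coef_ge0_of_eventually (p : {poly rat}) k n0 :
    (forall n, (n0 <= n)%N -> 0 <= p.[n%:R]) -> (size p <= k.+1)%N ->
  0 <= p`_k.
Proof.
move=> p_ge0 szp; rewrite leNgt; apply/negP => pk_lt0.
have szpk : size p = k.+1.
  apply/eqP; rewrite eqn_leq szp ltnNge; apply/negP => lek.
  by rewrite nth_default ?ltxx in pk_lt0.
have lc : 0 < lead_coef (- p).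
  by rewrite lead_coefN oppr_gt0 lead_coefE szpk.
have [x0 x0P] := polyrcf.poly_pinfty_gt_lc lc.
pose n := maxn n0 (Num.truncn `|x0|).+1.
have := p_ge0 n (leq_maxl _ _).
have : x0 <= n%:R.
  rewrite (le_trans (ler_norm _)) // ltW // (lt_le_trans (truncnS_gt _)) //.
  by rewrite ler_nat leq_maxr.
move/x0P/(lt_le_trans lc); rewrite hornerN oppr_gt0 => lt0 ge0.
by have := lt_le_trans lt0 ge0; rewrite ltxx.
Qed.

(** The upper bound caps the degree of P at k, and then the lower bound forces
    the coefficient of degree k to be at least N / k!, hence nonzero. *)
Lemma poly_growth_lead (P : {poly rat}) k N (A B r : rat) n0 :
    (0 < N)%N ->
    (forall n, (n0 <= n)%N ->
      N%:R * (n%:R - r) ^+ k <= P.[n%:R] * k`!%:R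
      /\ P.[n%:R] <= (A * n%:R + B) ^+ k) ->
    (forall n, (n0 <= n)%N -> 0 <= P.[n%:R]) ->
  size P = k.+1 /\ N%:R <= lead_coef P * k`!%:R.
Proof.
move=> N_gt0 boundP P_ge0.
have szP : (size P <= k.+1)%N.
  rewrite leqNgt; apply/negP => ltP; pose j := (size P).-1.
  have szj : size P = j.+1 by rewrite /j; case: (size P) ltP.
  pose R := (A *: 'X + B%:P) ^+ k - P.
  have szU : (size ((A *: 'X + B%:P) ^+ k)%R <= k.+1)%N.
    rewrite (leq_trans (size_poly_exp_leq _ _)) // ltnS -[leqRHS]mul1n leq_mul2r.
    apply/orP; right; suff: (size (A *: 'X + B%:P)%R <= 2)%N by case: (size _).
    rewrite (leq_trans (size_polyD _ _)) // geq_max.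
    by rewrite (leq_trans (size_scale_leq _ _)) ?size_polyX // (leq_trans (size_polyC_leq1 _)).
  have Rj : R`_j = - P`_j by rewrite coefB nth_default ?sub0r // (leq_trans szU) // -ltnS -szj.
  have : 0 <= R`_j.
    apply: (@coef_ge0_of_eventually _ _ n0) => [n /boundP[_ leP]|].
      by rewrite !hornerE subr_ge0.
    rewrite -szj (leq_trans (size_polyD _ _)) // size_polyN geq_max leqnn andbT.
    exact: leq_trans szU (ltnW ltP).
  rewrite Rj oppr_ge0 => Pj_le0.
  have : 0 <= P`_j by apply: coef_ge0_of_eventually P_ge0 _; rewrite szj.
  rewrite le_eqVlt ltNge Pj_le0 orbF eq_sym => /eqP Pj0.
  have: lead_coef P == 0 by rewrite lead_coefE -/j Pj0.
  by rewrite lead_coef_eq0 -size_poly_eq0 szj.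
have leN : N%:R <= P`_k * k`!%:R.
  pose Q := k`!%:R *: P - N%:R *: ('X - r%:P) ^+ k.
  have Qk : Q`_k = P`_k * k`!%:R - N%:R.
    rewrite coefB !coefZ mulrC; congr (_ - _).
    have := monic_exp k (monicXsubC r); rewrite monicE lead_coefE.
    by rewrite size_exp_XsubC => /eqP ->; rewrite mulr1.
  rewrite -subr_ge0 -Qk; apply: (@coef_ge0_of_eventually _ _ n0).
    move=> n /boundP[leP _]; rewrite !hornerE subr_ge0.
    by rewrite [leRHS]mulrC.
  rewrite (leq_trans (size_polyD _ _)) // size_polyN geq_max.
  apply/andP; split; apply: leq_trans (size_scale_leq _ _) _ => //.
  by rewrite size_exp_XsubC.
have szPk : size P = k.+1.
  apply/eqP; rewrite eqn_leq szP ltnNge; apply/negP => lek.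
  by move: leN; rewrite nth_default // mul0r leNgt ltr0n N_gt0.
by split=> //; rewrite lead_coefE szPk.
Qed.

End PolynomialGrowth.

(** * Residue classes of the semigroup *)

Section ResidueClasses.
Context (c d alpha : nat) (a : 'I_c -> 'X_{1..d}).
Implicit Types (m : 'X_{1..c + d}) (v : 'X_{1..d}).

Local Notation phi := (toric_exp alpha a).
Local Notation gen := (simplicial_gen alpha a).

Definition residue v : 'X_{1..d} := [multinom v j %% alpha | j < d]%N.

(** The image of m lies in no e_j + S: these elements form the Apery set of S
    with respect to e_1, ..., e_d. *)
Definition apery m := forall m', phi m' = phi m -> ydeg m' = 0%N.

Lemma apery_le m1 m2 : (m1 <= m2)%MM -> apery m2 -> apery m1.
Proof.
move=> le12 ap2 m' eqm'; have := ap2 (m' + (m2 - m1))%MM.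
rewrite toric_expD eqm' -toric_expD addmC submK // ydegD => /(_ erefl).
by move/eqP; rewrite addn_eq0 => /andP[/eqP].
Qed.

(** Congruent images that are comparable differ by a sum of elements e_j, and
    a nonzero such sum is excluded by the Apery property. *)
Lemma apery_residue_inj m1 m2 :
    apery m2 -> (phi m1 <= phi m2)%MM ->
    residue (phi m1) = residue (phi m2) ->
  phi m1 = phi m2.
Proof.
move=> ap2 le12 eqres.
pose v := [multinom (phi m2 j - phi m1 j) %/ alpha | j < d]%N.
have eqv : phi (m1 + ymon c v)%MM = phi m2.
  apply/mnmP => j; rewrite toric_expD toric_exp_ymon mnmDE mulmnE mnmE.
  have le12j := mnm_lepP le12 j; rewrite divnK ?subnKC //.
  rewrite -eqn_mod_dvd // eq_sym.
  by have := congr1 (fun v : 'X_{1..d} => v j) eqres; rewrite !mnmE => ->.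
have := ap2 _ eqv; rewrite ydegD ydeg_ymon => /eqP.
rewrite addn_eq0 => /andP[_]; rewrite mdeg_eq0 => /eqP v0.
by rewrite -eqv toric_expD toric_exp_ymon v0; apply/mnmP => j; rewrite mnmDE mulmnE mnm0E addn0.
Qed.

Lemma mdeg_s2m n (s : seq 'I_n) : mdeg (s2m s) = size s.
Proof.
elim: s => [|i s IHs]; first by rewrite mdegE big1 // => j _; rewrite mnmE.
transitivity (mdeg (U_(i) + s2m s)%MM); last by rewrite mdegD mdeg1 IHs add1n.
congr mdeg; by apply/mnmP => j; rewrite mnmDE mnm1E !mnmE.
Qed.

(** A chain of divisors of m, one in each degree k up to the degree of m. *)
Definition prefix_mnm m k := s2m (take k (m2s m)).

Lemma prefix_mnm_le m k l : (k <= l)%N -> (prefix_mnm m k <= prefix_mnm m l)%MM.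
Proof.
move=> lekl; apply/mnm_lepP => i; rewrite !mnmE.
by rewrite -(subnKC lekl) takeD count_cat leq_addr.
Qed.

Lemma prefix_mnm_le_self m k : (prefix_mnm m k <= m)%MM.
Proof.
apply/mnm_lepP => i; rewrite -{2}(s2mK m) !mnmE.
by rewrite -{2}(cat_take_drop k (m2s m)) count_cat leq_addr.
Qed.

Lemma mdeg_prefix_mnm m k : (k <= mdeg m)%N -> mdeg (prefix_mnm m k) = k.
Proof. by move=> lek; rewrite mdeg_s2m size_takel // size_m2s. Qed.

Context (a_deg : forall i, mdeg (a i) = alpha).
Context (alpha_gt0 : (0 < alpha)%N).
Context (gen_inj : injective gen).

(** A coordinate equal to alpha would use up the whole degree of a_i and make
    it equal to e_j; so a_i is its own residue modulo alpha. *)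
Lemma coord_lt i j : (a i j < alpha)%N.
Proof.
rewrite ltnNge; apply/negP => leaij.
have ai0 k : k != j -> a i k = 0%N.
  move=> nekj; move: (a_deg i); rewrite mdegE (bigD1 j) //= (bigD1 k) //=.
  by move: leaij; lia.
have aij : a i j = alpha.
  by have := a_deg i; rewrite mdegE (bigD1 j) //= big1 ?addn0.
have /gen_inj/eqP : gen (lshift d i) = gen (rshift c j).
  rewrite gen_lshift gen_rshift; apply/mnmP => k; rewrite mulmnE mnm1E.
  by have [<-|/negPf nejk] := eqVneq j k; rewrite ?aij ?mul1n // ai0 // eq_sym nejk.
by rewrite eq_lrshift.
Qed.

Lemma residue_gen i : residue (a i) = a i.
Proof. by apply/mnmP => j; rewrite mnmE modn_small ?coord_lt. Qed.

Lemma residue0 : residue 0%MM = 0%MM.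
Proof. by apply/mnmP => j; rewrite mnmE !mnm0E mod0n. Qed.

Lemma residue_le v : (residue v <= v)%MM.
Proof. by apply/mnm_lepP => j; rewrite mnmE leq_mod. Qed.

Lemma residueK v w : residue (v + w *+ alpha)%MM = residue v.
Proof.
by apply/mnmP => j; rewrite !mnmE mulmnE -modnDmr modnMl addn0.
Qed.

(** The c + r representatives are 1, the variables x_i and the prefixes of m of
    degree at least 2.  The prefix of degree 1 is left out because it is one
    of the x_i. *)
Lemma apery_residues r m : mdeg m = r -> (0 < r)%N -> apery m ->
  exists s : seq 'X_{1..c + d},
    [/\ size s = (c + r)%N, uniq [seq residue (phi x) | x <- s]
      & forall x, x \in s -> (mdeg x <= r)%N].
Proof.
move=> degm r_gt0 ap_m; pose p k := prefix_mnm m k.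
have ap_p k : apery (p k) by apply: apery_le ap_m; apply: prefix_mnm_le_self.
have deg_p k : (k <= r)%N -> mdeg (p k) = k.
  by move=> lekr; rewrite mdeg_prefix_mnm ?degm.
exists (0%MM :: [seq U_(lshift d i)%MM | i <- enum 'I_c] ++ [seq p k | k <- iota 2 r.-1]).
have phiU i : phi U_(lshift d i)%MM = a i by rewrite toric_expU gen_lshift.
split.
- rewrite /= size_cat !size_map size_iota -enumT size_enum_ord.
  by rewrite -addnS prednK.
- rewrite /= toric_exp0 residue0 map_cat -!map_comp cat_uniq.
  apply/and4P; split.
  + rewrite mem_cat; apply/norP; split; apply/mapP => -[].
      move=> i _ /= /esym; rewrite phiU residue_gen => /(congr1 mdeg).
      by rewrite a_deg mdeg0; lia.
    move=> k; rewrite mem_iota => kr /= eq0.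
    have le0 : (phi 0%MM <= phi (p k))%MM.
      by apply/mnm_lepP => j; rewrite toric_exp0 mnm0E.
    rewrite -residue0 -(toric_exp0 alpha a) in eq0.
    have := toric_exp_mdeg a_deg alpha_gt0 (apery_residue_inj (ap_p k) le0 eq0).
    by rewrite mdeg0 deg_p; lia.
  + rewrite map_inj_uniq -?enumT ?enum_uniq // => i i' /=.
    rewrite !phiU !residue_gen -(gen_lshift alpha) -[a i'](gen_lshift alpha).
    by move/gen_inj/lshift_inj.
  + apply/hasPn => _ /mapP[k + ->]; rewrite mem_iota => kr; apply/mapP => -[i _ /= eqr].
    have leU : (phi U_(lshift d i) <= phi (p k))%MM.
      by rewrite phiU -residue_gen -phiU -eqr residue_le.
    have := toric_exp_mdeg a_deg alpha_gt0
      (apery_residue_inj (ap_p k) leU (esym eqr)).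
    by rewrite mdeg1 deg_p; lia.
  + rewrite map_inj_in_uniq ?iota_uniq // => k l.
    rewrite !mem_iota => kr lr /= eqr; wlog lekl : k l kr lr eqr / (k <= l)%N.
      by move=> th; case/orP: (leq_total k l) => le; [|apply/esym]; apply: th.
    have := toric_exp_mdeg a_deg alpha_gt0 (apery_residue_inj (ap_p l)
      (toric_exp_le _ _ (prefix_mnm_le m lekl)) eqr).
    by rewrite !deg_p; lia.
- move=> x; rewrite inE mem_cat => /or3P[/eqP->|/mapP[i _ ->]|/mapP[k]].
  + by rewrite mdeg0.
  + by rewrite mdeg1.
  + by rewrite mem_iota => kr ->; rewrite deg_p; lia.
Qed.

(** Otherwise every element of S of degree r+1 would lie in some e_j + S, and
    splitting an element of K[S] into its terms would show that the reduction
    already happens at r.  The fibres of phi are finite, so the alternative is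
    decidable. *)
Lemma apery_of_reduction_number (K : fieldType) r :
  is_reduction_number alpha a K r.+1 -> exists2 m, mdeg m = r.+1 & apery m.
Proof.
move=> [_ min_r].
have [/existsP[m /andP[/eqP degm /forallP yfree]]|] :=
  boolP [exists m : bmultinom (c + d) r.+2, (mdeg m == r.+1) &&
    [forall m' : bmultinom (c + d) r.+2, (phi m' == phi m) ==> (ydeg m' == 0%N)]].
  exists m => // m' eqm'; have degm' := toric_exp_mdeg a_deg alpha_gt0 eqm'.
  have ltm' : (mdeg m' < r.+2)%N by rewrite degm' degm.
  by have /implyP/(_ _)/eqP := yfree (BMultinom ltm'); apply; apply/eqP.
rewrite negb_exists => /forallP noap.
suff /min_r : reduces_at alpha a K r by rewrite ltnn.
have red v : in_semigroup alpha a v -> mdeg v = (r.+1 * alpha)%N ->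
    exists jw, [/\ in_semigroup alpha a jw.2 & v = (U_(jw.1) *+ alpha + jw.2)%MM].
  move=> /in_semigroupP[m ->]; rewrite (mdeg_toric_exp a_deg) => /eqP.
  rewrite eqn_pmul2r // => degm.
  have ltm : (mdeg m < r.+2)%N by rewrite (eqP degm).
  have := noap (BMultinom ltm); rewrite /= degm /= negb_forall => /existsP[m'].
  rewrite negb_imply -lt0n => /andP[/eqP <- /ydeg_gt0[j ym']].
  exists (j, phi (m' - U_(rshift c j))%MM); split.
    by apply/in_semigroupP; exists (m' - U_(rshift c j))%MM.
  rewrite -(gen_rshift alpha a) -toric_expU -toric_expD addmC submK //.
  by rewrite lep1mP -lt0n.
move=> f; split=> [[]//|Sf]; split=> //; case: Sf => Sf /dhomogP homf.
(* Collect one summand t_j^alpha * t^w for each term of f. *)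
have decomp (s : seq 'X_{1..d}) : {subset s <= msupp f} ->
  exists u : seq ('I_d * {mpoly K[d]}),
    (forall x, x \in u -> semigroup_algebra alpha a x.2) /\
    \sum_(v <- s) f@_v *: 'X_[v] = \sum_(x <- u) 'X_(x.1) ^+ alpha * x.2.
  elim: s => [|v s IHs] sf; first by exists [::]; rewrite !big_nil.
  have [|u [Su equ]] := IHs; first by move=> w sw; apply: sf; rewrite inE sw orbT.
  have fv : v \in msupp f by apply: sf; rewrite inE eqxx.
  have [[j w] [Sw eqv]] := red v (Sf v fv) (homf v fv).
  exists ((j, f@_v *: 'X_[w]) :: u); split=> [x|].
    rewrite inE => /orP[/eqP-> w' /msuppZ_le|/Su //].
    by rewrite msuppX inE => /eqP->.
  rewrite !big_cons equ; congr (_ + _).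
  by rewrite mpolyXn -scalerAr -mpolyXD -eqv.
have [u [Su]] := decomp _ (fun v => id); rewrite -mpolyE => ->.
exists (fun j => \sum_(x <- u | x.1 == j) x.2); split=> [j v|].
  move/msupp_sum_le/flattenP => [_ /mapP[x + ->]]; rewrite mem_filter => /andP[_ ux].
  exact: Su.
rewrite (partition_big (fun x => x.1) xpredT) //=; apply: eq_bigr => j _.
by rewrite big_distrr; apply: eq_bigr => x /eqP ->.
Qed.

End ResidueClasses.

(** * Hilbert function *)

Section HilbertFunction.
Context (K : fieldType) (c k alpha : nat) (a : 'I_c -> 'X_{1..k.+1}).

Local Notation phi := (toric_exp alpha a).
Local Notation degree_part n := (@semigroup_algebra_homog c k.+1 alpha a K n).

Definition monomials_of_degree N : seq 'X_{1..k.+1} :=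
  [seq s2m (val t) | t <- enum (basis k.+1 N)].

(** Each representative phi m is translated by alpha times the monomials of
    degree n - mdeg m.  Only those divisible by t_0^(r - mdeg m) are used, so
    that the number of translates does not depend on m; different residues
    give different elements. *)
Lemma hilbert_function_geq r (s : seq 'X_{1..c + k.+1}) n D :
    (forall i, mdeg (a i) = alpha) -> (0 < alpha)%N ->
    uniq [seq residue alpha (phi m) | m <- s] ->
    (forall m, m \in s -> (mdeg m <= r)%N) -> (r <= n)%N ->
    has_dimension (degree_part n) D ->
  (size s * 'C(n - r + k, k) <= D)%N.
Proof.
move=> a_deg alpha_gt0 uniq_s deg_s lern dimD.
pose e (m : 'X_{1..c + k.+1}) v : 'X_{1..k.+1} :=
  (v + U_(ord0) *+ (r - mdeg m))%MM.
pose L := [seq (phi m + e m v *+ alpha)%MM | m <- s, v <- monomials_of_degree (n - r)].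
have -> : (size s * 'C(n - r + k, k))%N = size L.
  rewrite size_allpairs size_basis -[in RHS]bin_sub ?leq_addr //.
  by rewrite addKn.
apply: has_dimension_geq dimD _ _ => [|v].
  apply: allpairs_uniq; [exact: map_uniq uniq_s | exact: uniq_basis |].
  move=> [m v] [m' v'] /allpairsPdep[m1 [v1 [sm _ [-> ->]]]].
  move=> /allpairsPdep[m2 [v2 [sm' _ [-> ->]]]] /= eqmv.
  have eqm : m1 = m2.
    move/(congr1 (residue alpha)): (eqmv); rewrite !residueK => eqr.
    have /(nth_index 0%MM) <- := sm; have /(nth_index 0%MM) <- := sm'.
    congr nth; apply/eqP.
    rewrite -(nth_uniq (residue alpha (phi 0%MM)) _ _ uniq_s) ?size_map ?index_mem //.
    by rewrite !(nth_map 0%MM) ?index_mem // !nth_index // eqr.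
  congr (_, _) => //; move: eqmv; rewrite eqm => /addmI eqe.
  apply: (@addIm _ (U_(ord0) *+ (r - mdeg m2))%MM); apply/mnmP => j.
  have := congr1 (fun v : 'X_{1..k.+1} => v j) eqe.
  by rewrite !mulmnE => /eqP; rewrite eqn_pmul2r // => /eqP.
move=> /allpairsPdep[m [v' [sm]]]; rewrite -basis_cover => /eqP degv ->.
split=> [w|].
  rewrite msuppX inE => /eqP->; apply/in_semigroupP.
  by exists (m + ymon c (e m v'))%MM; rewrite toric_expD toric_exp_ymon.
rewrite dhomogX /= mdegD mdegMn (mdeg_toric_exp a_deg) !mdegD mdegMn mdeg1.
by rewrite mul1n degv -mulnDl; have lem := deg_s m sm; apply/eqP; congr (_ * _)%N; lia.
Qed.

Lemma hilbert_function_leq n D :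
  has_dimension (degree_part n) D -> (D <= 'C(n * alpha + k, k))%N.
Proof.
move=> dimD; have -> : 'C(n * alpha + k, k) = size (monomials_of_degree (n * alpha)).
  by rewrite size_basis -[in RHS]bin_sub ?leq_addr // addKn.
apply: has_dimension_leq dimD _ => f [_ /dhomogP homf] m fm.
by rewrite -basis_cover; apply/eqP/homf.
Qed.

Lemma bin_fact_geq p : (p ^ k <= 'C(p + k, k) * k`!)%N.
Proof.
rewrite bin_ffact ffact_prod -[X in (_ ^ X <= _)%N](card_ord k) -prod_nat_const.
by apply: leq_prod => i _; have := ltn_ord i; lia.
Qed.

Lemma bin_leq_exp p : ('C(p + k, k) <= (p + k) ^ k)%N.
Proof.
apply: (@leq_trans ('C(p + k, k) * k`!)); first by rewrite leq_pmulr ?fact_gt0.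
rewrite bin_ffact ffact_prod -[X in (_ <= _ ^ X)%N](card_ord k) -prod_nat_const.
by apply: leq_prod => i _; lia.
Qed.

(** The two estimates of the Hilbert function give growth of order n^k, with
    coefficient at least the number of residues. *)
Lemma hilbert_polynomial_lead r (s : seq 'X_{1..c + k.+1}) P :
    (forall i, mdeg (a i) = alpha) -> (0 < alpha)%N -> s != [::] ->
    uniq [seq residue alpha (phi m) | m <- s] ->
    (forall m, m \in s -> (mdeg m <= r)%N) ->
    is_hilbert_polynomial alpha a K P ->
  hilbert_dim P = k.+1 /\ (size s)%:R <= hilbert_multiplicity P.
Proof.
move=> a_deg alpha_gt0 s_neq0 uniq_s deg_s [n0 hilbP].
rewrite /hilbert_multiplicity /hilbert_dim.
have [|n ltn|n ltn|szP leP] :=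
    @poly_growth_lead P k (size s) alpha%:R k%:R r%:R (maxn n0 r).
- by rewrite lt0n size_eq0.
- have [D dimD ->] := hilbP n (leq_trans (leq_maxl _ _) ltn).
  have lern := leq_trans (leq_maxr _ _) ltn.
  have geD := hilbert_function_geq a_deg alpha_gt0 uniq_s deg_s lern dimD.
  have leD := leq_trans (hilbert_function_leq dimD) (bin_leq_exp _).
  split; last by rewrite -natrM -natrD -natrX ler_nat mulnC.
  rewrite -natrB // -natrX -!natrM ler_nat.
  apply: (@leq_trans (size s * ('C(n - r + k, k) * k`!))).
    by rewrite leq_mul2l bin_fact_geq orbT.
  by rewrite mulnA leq_mul2r geD orbT.
- by have [D _ ->] := hilbP n (leq_trans (leq_maxl _ _) ltn).
by rewrite szP.
Qed.

End HilbertFunction.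

(** * Degree bounds for Groebner bases *)

Theorem theorem1p1 (K : fieldType) (c d alpha : nat) (a : 'I_c -> 'X_{1..d})
    (c_ge2 : (2 <= c)%N) (alpha_ge2 : (2 <= alpha)%N)
    (a_deg : forall i : 'I_c, mdeg (a i) = alpha)
    (gen_distinct : injective (simplicial_gen alpha a))
    (a_coprime : coord_gcd a = 1%N)
    (r : nat) (r_red : is_reduction_number alpha a K r)
    (P : {poly rat}) (P_hilb : is_hilbert_polynomial alpha a K P) :
  (forall G : seq {mpoly K[c + d]},
     minimal_groebner_basis (@toric_ideal c d alpha a K) G ->
     (max_degree G)%:R <= Num.max (r%:R + 1) (2 * r%:R - 1) :> rat)
  /\ Num.max (r%:R + 1) (2 * r%:R - 1)
     <= Num.max 2 (2 * (hilbert_multiplicity P - hilbert_codim (c + d) P) - 1)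
     :> rat.
Proof.
have alpha_gt0 : (0 < alpha)%N by apply: ltnW.
split=> [G minG|].
  have := max_degree_minimal_groebner a_deg alpha_gt0 r_red.1 minG.
  rewrite le_max natr1 => /orP[|]; rewrite -(ler_nat rat) => le_deg.
    by rewrite le_deg.
  apply/orP; right; move: le_deg; rewrite -addnn natrD -natr1; lra.
have [r_le1|r_gt1] := leqP r 1.
  by rewrite le_max ge_max -!natrM; apply/orP; left; case: r r_le1 r_red => [|[]].
case: d => [|k] in a a_deg gen_distinct a_coprime r_red P_hilb *.
  (* With d = 0 the a_i would have degree 0. *)
  have i : 'I_c by apply: (@Ordinal c 0); apply: ltnW.
  by have := a_deg i; rewrite mdegE big_ord0 => alpha0; rewrite -alpha0 in alpha_gt0.
case: r => // r in r_gt1 r_red *.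
have [m degm ap_m] := apery_of_reduction_number a_deg alpha_gt0 r_red.
have [s [sz_s uniq_s deg_s]] :=
  apery_residues a_deg alpha_gt0 gen_distinct degm isT ap_m.
have s_neq0 : s != [::] by rewrite -size_eq0 sz_s addnS.
have [dimP] :=
  hilbert_polynomial_lead a_deg alpha_gt0 s_neq0 uniq_s deg_s P_hilb.
rewrite /hilbert_codim dimP sz_s natrD !natrD => le_mult.
have : (2 : rat) <= r.+1%:R by rewrite (ler_nat _ 2).
rewrite le_max !ge_max; move: (hilbert_multiplicity P) le_mult => e le_mult r2.
by apply/orP; right; apply/andP; split; lra.
Qed.
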